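(* Let $q$ be a prime power and $n\ge 2$. If $E$ and $F$ are $\mathbb F_q$-subspaces of $\mathbb F_{q^n}$ with $\mathbb F_{q^n}=E\oplus F$, then \[ \sum_{0\ne u\in E}\frac 1{u^{q-1}}\ne 0\iff \sum_{0\ne v\in L_E(F)}\frac 1{v^{q-1}}\ne 0, \] where $L_E(X)=\prod_{u\in E}(X-u)$. In particular, for each $1\le k\le n-1$, $g_{q-1}$ is not $k$th order sum-free on $\mathbb F_{q^n}$ if and only if it is not $(n-k)$th order sum-free.
   Context: $L_E$ is an $\mathbb F_q$-linear map of $\mathbb F_{q^n}$ with kernel $E$. $g_{q-1}(x)=1/x^{q-1}$ for $x\ne0$, $g_{q-1}(0)=0$. A function $f:\mathbb F_{q^n}\to\mathbb F_{q^n}$ is $k$th order sum-free if $\sum_{x\in A}f(x)\ne0$ for every $k$-dimensional $\mathbb F_q$-affine subspace $A$ of $\mathbb F_{q^n}$. *)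

(* Defs.v *)
From HB Require Import structures.
From mathcomp Require Import all_boot all_order all_fingroup all_algebra.
From mathcomp Require Import all_solvable all_field.

Set Implicit Arguments.
Unset Strict Implicit.
Unset Printing Implicit Defensive.

Import GRing.Theory.
Local Open Scope ring_scope.

(* A finite extension L of the finite field Fq is used as a finite type       *)
(* through mathcomp's alias [finvect_type L], which is convertible to L and    *)
(* also carries its field and Fq-vector space structures.                      *)

Section SumFree.
Variables (Fq : finFieldType) (L : fieldExtType Fq).
Local Notation fL := (finvect_type L).

Definition affine_subspace (k : nat) (A : {set fL}) : Prop :=
  exists (a : fL) (W : {vspace fL}),
    \dim W = k /\ A = [set a + w | w in W].

Definition sum_free (k : nat) (f : fL -> fL) : Prop :=
  forall A : {set fL}, affine_subspace k A -> \sum_(x in A) f x != 0.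

Definition ginv (d : nat) (x : fL) : fL :=
  if x == 0 then 0 else 1 / x ^+ d.

Definition subspace_poly (E : {vspace fL}) : {poly fL} :=
  \prod_(u in E) ('X - u%:P).

Definition subspace_poly_image (E F : {vspace fL}) : {set fL} :=
  [set (subspace_poly E).[x] | x in F].

End SumFree.

Arguments ginv {Fq} L d x.

(* Main.v *)
(* Write L_E = a0 X + a1 X^q + (higher terms).  Newton's identities for the
   reciprocals of the roots of L_E / X give sum_(0 <> u in E) u^(1-q) = a1 / a0.
   If M = L_(L_E(F)) = b0 X + b1 X^q + ..., then M o L_E = X^(q^n) - X, whose
   coefficient at X^q is b0 a1 + b1 a0^q = 0; since a0 and b0 are nonzero, a1 and
   b1 vanish together.  For the second part, an affine subspace a + W that misses 0
   never gives a zero sum: prod_(w in W) (X - (a + w)) = L_W(X) - L_W(a) by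
   additivity of L_W, and Newton's identities yield (a0 / L_W(a))^(q-1) <> 0. *)

Require Import Defs.
From HB Require Import structures.
From mathcomp Require Import all_boot all_order all_fingroup all_algebra.
From mathcomp Require Import all_solvable all_field.
From mathcomp Require Import ring.

Set Implicit Arguments.
Unset Strict Implicit.
Unset Printing Implicit Defensive.

Import GRing.Theory.
Local Open Scope ring_scope.

(** * Newton's identities, in truncated form *)

Section PowerSums.
Variables (K : comNzRingType) (I : finType) (P : pred I) (v : I -> K).

Let Q : {poly K} := \prod_(i | P i) (1 - (v i)%:P * 'X).

Lemma geometric_modX (c : K) (m : nat) :
  (1 - c%:P * 'X) * \sum_(k < m) (c ^+ k.+1)%:P * 'X^k
    = c%:P - (c ^+ m.+1)%:P * 'X^m :> {poly K}.
Proof.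
elim: m => [|m IH]; first by rewrite big_ord0 mulr0 expr1 expr0 mulr1 subrr.
by rewrite big_ord_recr mulrDr IH [c ^+ m.+2]exprS polyCM !exprS; ring.
Qed.

(** Logarithmic derivative: -Q'/Q is the sum of v_i/(1 - v_i X). Expanding each fraction as a
    geometric series cut at X^m keeps the identity inside polynomials. *)
Lemma newton_modX (m : nat) : exists r : {poly K},
  Q * (\sum_(i | P i) \sum_(k < m) (v i ^+ k.+1)%:P * 'X^k)
    = - Q^`() + 'X^m * r.
Proof.
rewrite /Q; pose R (q s : {poly K}) := exists r, q * s = - q^`() + 'X^m * r.
apply: (big_rec2 R) => [|i q s _ [r qs]].
  by exists 0; rewrite derivE mulr0 mulr0 addr0 oppr0.
set g := \sum_(k < m) _; set c := v i.
(* The product rule adds up two remainders: that of the new geometric sum, times [q], and the old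
   one times the new factor. *)
exists (- (c ^+ m.+1)%:P * q + (1 - c%:P * 'X) * r).
have -> : (1 - c%:P * 'X) * q * (g + s)
    = ((1 - c%:P * 'X) * g) * q + (1 - c%:P * 'X) * (q * s) by ring.
rewrite geometric_modX qs !derivE; ring.
Qed.

Lemma coef_power_sums (m : nat) (j : 'I_m) :
  (\sum_(i | P i) \sum_(k < m) (v i ^+ k.+1)%:P * 'X^k)`_j
    = \sum_(i | P i) v i ^+ j.+1 :> K.
Proof.
rewrite coef_sum; apply: eq_bigr => i _.
rewrite coef_sum (bigD1 j) //= coefCM coefXn eqxx mulr1 big1 ?addr0 // => k kj.
by rewrite coefCM coefXn eq_sym (negbTE (kj : val k != val j)) mulr0.
Qed.

(** Up to degree m+1, [Q] agrees with the polynomial having the single reciprocal root [c], so the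
    power sums up to that order are those of [c] alone. *)
Lemma power_sum_linear (m : nat) (c : K) (s : {poly K}) :
  Q = 1 - c%:P * 'X + 'X^(m.+2) * s -> \sum_(i | P i) v i ^+ m.+1 = c ^+ m.+1.
Proof.
move=> EQ; have [r] := newton_modX m.+1; set S := \sum_(i | P i) _.
have coefS : S`_m = \sum_(i | P i) v i ^+ m.+1 := coef_power_sums ord_max.
rewrite -{}coefS; move: S Q EQ => S q EQ.
have -> : - q^`() = c%:P - 'X^(m.+1) * (m.+2%:R * s + 'X * s^`()).
  by rewrite EQ !derivE /= !exprS; ring.
move=> E.
(* Solving for [S] turns the identity into a recursion: below degree m+1, each coefficient is [c]
   times the previous one. *)
have {E}E : S = c%:P + c%:P * 'X * S
     + 'X^(m.+1) * (r - (m.+2%:R * s + 'X * s^`()) - 'X * s * S).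
  have ES : S = q * S + c%:P * 'X * S - 'X^(m.+2) * s * S.
    by rewrite EQ !exprS; ring.
  by rewrite [LHS]ES E !exprS; ring.
have cS (j : nat) : (j < m.+1)%N -> S`_j = c ^+ j.+1.
  elim: j => [|j IH] jm; rewrite E !coefD coefXnM jm addr0 coefC -mulrA coefCM.
    by rewrite coefXM mulr0 addr0 expr1.
  by rewrite coefXM /= add0r IH ?exprS // ltnW.
exact: cS.
Qed.

(** With no terms in degrees 1 to m, Newton's identity of order m+1 reduces to its last term. *)
Lemma power_sum_top (m : nat) (b : K) (s : {poly K}) :
  Q = 1 + b%:P * 'X^(m.+1) + 'X^(m.+2) * s ->
  \sum_(i | P i) v i ^+ m.+1 = - (m.+1%:R * b).
Proof.
move=> EQ; have [r] := newton_modX m.+1; set S := \sum_(i | P i) _.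
have coefS : S`_m = \sum_(i | P i) v i ^+ m.+1 := coef_power_sums ord_max.
rewrite -{}coefS; move: S Q EQ => S q EQ.
have -> : - q^`() = - (m.+1%:R * b%:P * 'X^m)
     - 'X^(m.+1) * (m.+2%:R * s + 'X * s^`()).
  by rewrite EQ !derivE /= !exprS; ring.
move=> E.
have {E}E : S = - (m.+1%:R * b%:P * 'X^m)
     + 'X^(m.+1) * (r - (m.+2%:R * s + 'X * s^`()) - (b%:P + 'X * s) * S).
  have ES : S = q * S - 'X^(m.+1) * (b%:P + 'X * s) * S.
    by rewrite EQ !exprS; ring.
  by rewrite [LHS]ES E !exprS; ring.
rewrite E coefD coefXnM ltnSn addr0 coefN.
by rewrite -polyC_natr -polyCM coefCM coefXn eqxx mulr1.
Qed.

End PowerSums.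

(** * Polynomials modulo X^(q+1) with terms only in X and X^q *)

Section LowTerms.
Variables (K : comNzRingType) (m : nat).
Hypothesis frobD : forall r s : {poly K}, (r + s) ^+ m.+2 = r ^+ m.+2 + s ^+ m.+2.

(* [m] stands for q - 2, so that 'X^(m.+2) is 'X^q. *)
Definition low_terms (p : {poly K}) (a0 a1 : K) :=
  exists s, p = a0%:P * 'X + a1%:P * 'X^(m.+2) + 'X^(m.+3) * s.

Lemma low_terms_expr (p : {poly K}) (a0 a1 : K) : low_terms p a0 a1 ->
  exists s, p ^+ m.+2 = (a0 ^+ m.+2)%:P * 'X^(m.+2) + 'X^(m.+3) * s.
Proof.
(* Everything beyond a0 X is X^2 t, whose q-th power is divisible by X^(2q), hence by X^(q+1). *)
case=> s ->; set t := a1%:P * 'X^m + 'X^(m.+1) * s.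
have -> : a0%:P * 'X + a1%:P * 'X^(m.+2) + 'X^(m.+3) * s = a0%:P * 'X + 'X * ('X * t).
  by rewrite /t !exprS; ring.
exists ('X^(m.+1) * t ^+ m.+2).
by rewrite frobD !exprMn -rmorphXn /= !exprS; ring.
Qed.

Lemma low_terms_frob (p : {poly K}) (d a0 a1 : K) : low_terms p a0 a1 ->
  exists b0 b1, low_terms (p ^+ m.+2 - d%:P * p) b0 b1.
Proof.
move=> pa; have [t ->] := low_terms_expr pa; have [s ->] := pa.
exists (- (d * a0)), (a0 ^+ m.+2 - d * a1), (t - d%:P * s).
by rewrite !(polyCN, polyCM, polyCD, polyCB); ring.
Qed.

Lemma low_terms_comp (p r : {poly K}) (a0 a1 b0 b1 : K) :
  low_terms p a0 a1 -> low_terms r b0 b1 ->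
  low_terms (r \Po p) (b0 * a0) (b0 * a1 + b1 * a0 ^+ m.+2).
Proof.
move=> pa [t ->]; have [x px] := low_terms_expr pa.
rewrite !comp_polyD (comp_polyM b0%:P) (comp_polyM b1%:P) (comp_polyM 'X^(m.+3)).
rewrite !comp_polyC !comp_Xn_poly comp_polyX.
rewrite [p ^+ m.+3]exprS px; move: (t \Po p) (a0 ^+ m.+2) => T A.
have [s ps] := pa; rewrite ps.
set u := a0%:P + a1%:P * 'X^(m.+1) + 'X^(m.+2) * s.
have -> : a0%:P * 'X + a1%:P * 'X^(m.+2) + 'X^(m.+3) * s = 'X * u.
  by rewrite /u !exprS; ring.
exists (b0%:P * s + b1%:P * x + u * (A%:P + 'X * x) * T).
by rewrite /u !polyCD !polyCM !exprS; ring.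
Qed.

Lemma coef_low_terms (p : {poly K}) (a0 a1 : K) :
  low_terms p a0 a1 -> p`_1 = a0 /\ p`_m.+2 = a1.
Proof.
case=> s ->; rewrite !coefD !coefCM !coefX !coefXn !coefXnM ltnSn eqxx.
by rewrite !mulr1 !mulr0 !addr0 add0r.
Qed.

End LowTerms.

(** * From roots to reciprocal roots *)

Lemma prod_inverse_roots (K : fieldType) (I : finType) (P : pred I) (y : I -> K) :
    (forall i, P i -> y i != 0) ->
  let p := \prod_(i | P i) ('X - (y i)%:P) in
  p.[0] != 0 /\
  \prod_(i | P i) (1 - ((y i)^-1)%:P * 'X) = (p.[0]^-1)%:P * p.
Proof.
move=> y0 p; have p0E : p.[0] = \prod_(i | P i) - y i.
  by rewrite horner_prod; apply: eq_bigr => i _; rewrite hornerXsubC sub0r.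
have p0 : p.[0] != 0 by rewrite p0E; apply/prodf_neq0 => i /y0; rewrite oppr_eq0.
split=> //; apply: (mulfI (x := p.[0]%:P)); first by rewrite polyC_eq0.
rewrite mulrA -polyCM mulfV // mul1r {1}p0E rmorph_prod -big_split.
apply: eq_bigr => i /y0 yi0 /=.
by rewrite mulrBr mulr1 mulrA -polyCM mulNr mulfV // !polyCN mulN1r opprK addrC.
Qed.

(** * Linearity and low terms of subspace polynomials *)

Section SubspacePoly.
Variables (Fq : finFieldType) (L : fieldExtType Fq) (m : nat).
Hypothesis card_Fq : #|Fq| = m.+2.
Local Notation fL := (finvect_type L).
Implicit Types (E F W : {vspace fL}) (p r s : {poly fL}).

(** The additive group of [Fq] is an elementary abelian p-group, so q is a power of p. *)
Lemma pchar_nat_card : [pchar Fq].-nat m.+2.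
Proof.
have [p pr_p pF] := finPcharP Fq.
rewrite (eq_pnat _ (pcharf_eq pF)) -card_Fq -cardsT.
exact: abelem_pgroup (fin_ring_pchar_abelem pF).
Qed.

Lemma exprD_card (A : comNzRingType) :
  [pchar A] =i [pchar Fq] -> forall x y : A, (x + y) ^+ m.+2 = x ^+ m.+2 + y ^+ m.+2.
Proof.
by move=> chA x y; rewrite exprDn_pchar ?(eq_pnat _ chA) ?pchar_nat_card.
Qed.

Lemma polyD_exp_card r s : (r + s) ^+ m.+2 = r ^+ m.+2 + s ^+ m.+2.
Proof. by apply: exprD_card => i; rewrite pchar_poly pchar_lalg. Qed.

Lemma card_natr0 : m.+2%:R = 0 :> fL.
Proof.
have [p pr_p pF] := finPcharP Fq.
have pL : p \in [pchar fL] by rewrite pchar_lalg.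
apply/eqP; rewrite -(dvdn_pcharf pL); have := pchar_nat_card.
rewrite (eq_pnat _ (pcharf_eq pF)) => /p_natP [[|e] em]; first by rewrite expn0 in em.
by rewrite em expnS dvdn_mulr.
Qed.

(** Linearity is required under composition, not just evaluation, because the variable itself gets
    substituted, as in L_E(X - a) = L_E(X) - L_E(a). *)
Definition polylinear p :=
  (forall r s, p \Po (r + s) = (p \Po r) + (p \Po s)) /\
  (forall (c : Fq) r, p \Po (c%:A%:P * r) = c%:A%:P * (p \Po r)).

Lemma polylinear_frob p (d : fL) :
  polylinear p -> polylinear (p ^+ m.+2 - d%:P * p).
Proof.
move=> [pD pZ]; split=> [r s | c r]; rewrite !comp_polyB !rmorphXn !comp_polyM !comp_polyC /=.
  by rewrite pD polyD_exp_card mulrDr opprD addrACA.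
by rewrite pZ exprMn -!rmorphXn /= -card_Fq -in_algE -rmorphXn expf_card mulrBr mulrCA.
Qed.

Lemma horner_polylinear p : polylinear p ->
  forall (c : Fq) (x y : fL), p.[c *: x + y] = c *: p.[x] + p.[y].
Proof.
move=> [pD pZ] c x y; apply: polyC_inj.
rewrite -comp_polyCr polyCD pD -(mulr_algl c x) polyCM pZ !comp_polyCr.
by rewrite -polyCM -polyCD mulr_algl.
Qed.

Lemma polylinearB p r s : polylinear p -> p \Po (r - s) = (p \Po r) - (p \Po s).
Proof.
move=> [pD pZ]; apply: (addIr (p \Po s)).
by rewrite -pD !subrK.
Qed.

Lemma horner_subspace_poly_eq0 E (a : fL) : ((subspace_poly E).[a] == 0) = (a \in E).
Proof.
rewrite horner_prod; apply/prodf_eq0/idP => [[u uE]|aE].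
  by rewrite hornerXsubC subr_eq0 => /eqP ->.
by exists a; rewrite ?hornerXsubC ?subrr.
Qed.

Lemma comp_subspace_poly E r :
  subspace_poly E \Po r = \prod_(u in E) (r - u%:P).
Proof.
by rewrite /subspace_poly rmorph_prod; apply: eq_bigr => u _ /=;
  rewrite comp_polyB comp_polyX comp_polyC.
Qed.

Lemma prod_shift_subspace E (a : fL) : polylinear (subspace_poly E) ->
  \prod_(u in E) ('X - (a + u)%:P) = subspace_poly E - (subspace_poly E).[a]%:P.
Proof.
move=> linE; rewrite -[X in X - _]comp_polyXr -comp_polyCr -polylinearB //.
by rewrite comp_subspace_poly; apply: eq_bigr => u _; rewrite polyCD; ring.
Qed.

(** The roots split into the cosets f + E with f in F, and each coset contributes L_E(X - f) =
    L_E(X) - L_E(f). *)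
Lemma subspace_poly_add E F :
  polylinear (subspace_poly E) -> directv (E + F) ->
  subspace_poly (E + F)
    = \prod_(f in F) (subspace_poly E - (subspace_poly E).[f]%:P).
Proof.
move=> linE dEF.
have -> : subspace_poly (E + F)
    = \prod_(z in [set h.1 + h.2 | h in [pred h | (h.1 \in F) && (h.2 \in E)]])
        ('X - z%:P).
  apply: eq_bigl => z; apply/memv_addP/imsetP => /= [[u uE [f fF ->]]|[[f u]]].
    by exists (f, u); rewrite ?inE /= ?fF ?uE // addrC.
  by rewrite !inE /= => /andP[fF uE] ->; exists u => //; exists f; rewrite // addrC.
rewrite big_imset /=; last first.
  move=> [f u] [f' u']; rewrite !inE /= => /andP[fF uE] /andP[fF' uE'] e.
  have := directv_add_unique dEF u u' f f' uE uE' fF fF'.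
  by rewrite addrC e addrC eqxx => /esym/eqP[-> ->].
rewrite -(pair_big_dep (mem F) (fun _ => mem E) (fun f u => 'X - (f + u)%:P)) /=.
by apply: eq_bigr => f _; rewrite prod_shift_subspace.
Qed.

(** Substitute p/y into the factorization of X^q - X over [Fq] and multiply by y^q. *)
Lemma prod_line_scaled (y : fL) p : y != 0 ->
  \prod_(c : Fq) (p - (c *: y)%:P) = p ^+ m.+2 - (y ^+ m.+1)%:P * p.
Proof.
move=> y0.
have /(congr1 (fun r : {poly Fq} => map_poly (in_alg fL) r \Po (y^-1%:P * p))) := finField_genPoly Fq.
rewrite card_Fq rmorphB /= map_polyXn map_polyX rmorph_prod comp_polyB rmorph_prod.
rewrite comp_Xn_poly comp_polyX => /= e.
have -> : \prod_(c : Fq) (p - (c *: y)%:P)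
    = (y ^+ m.+2)%:P * \prod_(c : Fq) (y^-1%:P * p - (c%:A)%:P).
  rewrite rmorphXn /= -card_Fq -[#|Fq|]/#|[pred c : Fq | true]| -prodr_const -big_split /=.
  apply: eq_bigr => c _.
  by rewrite mulrBr mulrA -!polyCM mulfV // mul1r mulr_algr.
under eq_bigr => c _ do rewrite -in_algE.
transitivity ((y ^+ m.+2)%:P * ((y^-1%:P * p) ^+ m.+2 - y^-1%:P * p)).
  rewrite e; congr (_ * _); apply: eq_bigr => c _.
  by rewrite rmorphB /= map_polyX map_polyC /= comp_polyB comp_polyX comp_polyC.
rewrite mulrBr exprMn mulrA -rmorphXn /= -polyCM -exprMn mulfV // expr1n mul1r.
by rewrite mulrA -polyCM [y ^+ m.+2]exprSr mulfK.
Qed.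

(** Induction on the dimension: splitting off a line spanned by w, with complement E', gives L_E =
    L_E'^q - L_E'(w)^(q-1) L_E', and this operation preserves both properties. *)
Lemma subspace_poly_linear E :
  polylinear (subspace_poly E) /\ exists a0 a1, low_terms m (subspace_poly E) a0 a1.
Proof.
have [d] := ubnP (\dim E); elim: d E => // d IH E dimE.
have [->|E0] := eqVneq E 0%VS.
  have -> : subspace_poly (0%VS : {vspace fL}) = 'X.
    rewrite /subspace_poly (big_pred1 0) => [|u]; first by rewrite subr0.
    by rewrite memv0.
  split; first by split=> *; rewrite !comp_polyX.
  by exists 1, 0, 0; rewrite mul0r mulr0 !addr0 mul1r.
set w := vpick E; have w0 : w != 0 by rewrite vpick0.
have wE : (<[w]> <= E)%VS by rewrite -memvE memv_pick.
set E' := (E :\: <[w]>)%VS.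
have defE : (E' + <[w]>)%VS = E by rewrite addv_diff; apply/addv_idPl.
have dE : directv (E' + <[w]>) by apply/directv_addP; rewrite capv_diff.
have [|linE [a0 [a1 lowE]]] := IH E'.
  have := dimv_cap_compl E <[w]>%VS; rewrite (capv_idPr wE) dim_vline w0 add1n.
  by move=> e; rewrite -ltnS e.
set y := (subspace_poly E').[w].
have y0 : y != 0.
  rewrite /y horner_subspace_poly_eq0; apply: contraNN w0 => wE'.
  by rewrite -memv0 -(capv_diff E <[w]>%VS) memv_cap memv_line andbT.
have -> : subspace_poly E = subspace_poly E' ^+ m.+2 - (y ^+ m.+1)%:P * subspace_poly E'.
  rewrite -[in LHS]defE subspace_poly_add // -prod_line_scaled //.
  have -> : \prod_(f in <[w]>%VS) (subspace_poly E' - (subspace_poly E').[f]%:P)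
    = \prod_(f in [set c *: w | c in [pred c : Fq | true]])
        (subspace_poly E' - (subspace_poly E').[f]%:P).
    apply: eq_bigl => f; apply/vlineP/imsetP => [[c ->]|[c _ ->]]; last by exists c.
    by exists c.
  rewrite big_imset /= => [|c c' _ _ /eqP]; last first.
    by rewrite -subr_eq0 -scalerBl scaler_eq0 (negbTE w0) orbF subr_eq0 => /eqP.
  apply: eq_bigr => c _; have := horner_polylinear linE c w 0.
  rewrite addr0 => ->.
  suff /eqP -> : (subspace_poly E').[0] == 0 by rewrite addr0.
  by rewrite horner_subspace_poly_eq0 mem0v.
split; first exact: polylinear_frob.
by apply: low_terms_frob lowE; apply: polyD_exp_card.
Qed.
End SubspacePoly.

(** * Sums of inverse powers over subspaces and their cosets *)

Section InverseSums.
Variables (Fq : finFieldType) (L : fieldExtType Fq) (m : nat).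
Hypothesis card_Fq : #|Fq| = m.+2.
Local Notation fL := (finvect_type L).
Implicit Types (E F W : {vspace fL}).

Lemma sum_inv_subspace E (a0 a1 : fL) : low_terms m (subspace_poly E) a0 a1 ->
  a0 != 0 /\ \sum_(u in E | u != 0) 1 / u ^+ m.+1 = a1 / a0.
Proof.
pose P (u : fL) := (u \in E) && (u != 0).
case=> s; rewrite /subspace_poly (bigD1 0) ?mem0v //= subr0 => Es.
set p := \prod_(u | P u) ('X - u%:P).
have pE : p = a0%:P + a1%:P * 'X^(m.+1) + 'X^(m.+2) * s.
  apply: (mulfI (negbT (polyX_eq0 fL))); rewrite Es; clear; move: a0%:P a1%:P => A0 A1.
  by rewrite !exprS; ring.
have [|p0 EQ] := @prod_inverse_roots fL fL P id; first by move=> u /andP[].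
rewrite -/p in p0 EQ.
have p0E : p.[0] = a0.
  by rewrite horner_coef0 pE !coefD coefC coefCM coefXn coefXnM /= mulr0 !addr0.
rewrite p0E in p0 EQ; split=> //.
transitivity (\sum_(u | P u) (u^-1) ^+ m.+1).
  by apply: eq_bigr => u _; rewrite div1r exprVn.
rewrite (@power_sum_top fL fL P (fun u => u^-1) m (a1 / a0) ((a0^-1)%:P * s)).
  (* The factor -(q-1) equals 1, since q = 0 in [fL]. *)
  apply/eqP; rewrite eq_sym -addr_eq0 mulr_natl -mulrS -mulr_natl.
  by rewrite (card_natr0 L card_Fq) mul0r.
rewrite EQ pE 2!mulrDr -polyCM mulVf // mulrA -polyCM [a0^-1 * a1]mulrC.
by rewrite mulrCA.
Qed.

Lemma sum_inv_affine E (a : fL) : a \notin E ->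
  \sum_(u in E) (a + u)^-1 ^+ m.+1 != 0.
Proof.
move=> aE; have [linE [a0 [a1 lowE]]] := subspace_poly_linear card_Fq E.
have [a0n0 _] := sum_inv_subspace lowE.
have ya u : u \in E -> a + u != 0.
  by move=> uE; apply: contraNneq aE => /eqP; rewrite addr_eq0 => /eqP ->; rewrite memvN.
have [] := prod_inverse_roots (P := mem E) ya.
rewrite prod_shift_subspace //; set b := (subspace_poly E).[a].
have b0 : b != 0 by rewrite horner_subspace_poly_eq0.
have /eqP E0 : (subspace_poly E).[0] == 0 by rewrite horner_subspace_poly_eq0 mem0v.
have [s Es] := lowE; rewrite hornerD hornerN hornerC E0 sub0r Es => _ EQ.
(* The product L_E(X) - b has value -b at 0; dividing by it leaves 1 - (a0/b) X plus terms of degree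
   at least q. *)
rewrite (@power_sum_linear fL fL (mem E) (fun u => (a + u)^-1) m (a0 / b)
  (- (b^-1)%:P * ((a1%:P + 'X * s)))).
  by rewrite expf_neq0 // mulf_neq0 // invr_eq0.
rewrite EQ invrN.
have : (b^-1)%:P * b%:P = 1 :> {poly fL} by rewrite -polyCM mulVf.
rewrite polyCM polyCN; move: (b^-1)%:P b%:P a0%:P a1%:P => C B A0 A1 CB.
by rewrite -CB !exprS; ring.
Qed.

Lemma subspace_poly_linfun E : exists phi : 'End(fL), forall x, phi x = (subspace_poly E).[x].
Proof.
have [linE _] := subspace_poly_linear card_Fq E.
pose f (x : fL) := (subspace_poly E).[x].
have f_lin : linear f by move=> c x y; apply: horner_polylinear.
pose lf : {linear fL -> fL} := HB.pack f (GRing.isLinear.Build Fq fL fL *:%R f f_lin).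
by exists (linfun lf) => x; rewrite lfunE.
Qed.

Lemma horner_subspace_poly_inj E F : directv (E + F) -> {in F &, injective (fun x => (subspace_poly E).[x])}.
Proof.
move=> dEF x y xF yF; have [phi phiE] := subspace_poly_linfun E.
move=> exy; have xyE : x - y \in E.
  by rewrite -horner_subspace_poly_eq0 -phiE linearB /= !phiE exy subrr.
apply/eqP; rewrite -subr_eq0 -memv0 -(directv_addP dEF) memv_cap xyE.
by rewrite memvB.
Qed.

(** L_E has kernel E, which meets F trivially, so it preserves the dimension of F. *)
Lemma subspace_poly_image_vspace E F : directv (E + F) ->
  exists2 F' : {vspace fL}, \dim F' = \dim F & subspace_poly_image E F =i F'.
Proof.
move=> dEF; have [phi phiE] := subspace_poly_linfun E.
exists (phi @: F)%VS.
  apply: limg_dim_eq; rewrite -(directv_addP dEF) capvC; congr (_ :&: _)%VS.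
  by apply/vspaceP => x; rewrite memv_ker phiE horner_subspace_poly_eq0.
move=> x; apply/imsetP/memv_imgP => [[u uF ->]|[u uF ->]]; exists u => //.
Qed.

Lemma subspace_poly_full :
  subspace_poly (fullv : {vspace fL}) = 'X^#|fL| - 'X.
Proof. by rewrite finField_genPoly; apply: eq_bigl => x; rewrite memvf. Qed.

Lemma comp_subspace_poly_image E F F' :
  directv (E + F) -> (E + F = fullv)%VS -> subspace_poly_image E F =i F' ->
  subspace_poly F' \Po subspace_poly E = 'X^#|fL| - 'X.
Proof.
move=> dEF EF imF; have [linE _] := subspace_poly_linear card_Fq E.
rewrite -subspace_poly_full -EF subspace_poly_add // comp_subspace_poly.
rewrite -(eq_bigl _ _ imF) big_imset //.
exact: horner_subspace_poly_inj.
Qed.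

Lemma sum_inv_complement E F : (2 <= \dim {:L})%N ->
  directv (E + F) -> (E + F = fullv)%VS ->
  (\sum_(u in E | u != 0) 1 / u ^+ m.+1 != 0) =
  (\sum_(v in subspace_poly_image E F | v != 0) 1 / v ^+ m.+1 != 0).
Proof.
move=> dimL dEF EF; have [F' _ imF] := subspace_poly_image_vspace dEF.
have [_ [a0 [a1 lowE]]] := subspace_poly_linear card_Fq E.
have [_ [b0 [b1 lowF]]] := subspace_poly_linear card_Fq F'.
have [a0n0 ->] := sum_inv_subspace lowE.
have [b0n0 sumF] := sum_inv_subspace lowF.
rewrite (eq_bigl (fun v => (v \in F') && (v != 0))) => [|v]; last by rewrite imF.
rewrite sumF.
have := low_terms_comp (polyD_exp_card card_Fq) lowE lowF.
rewrite (comp_subspace_poly_image dEF EF imF) => /coef_low_terms[_].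
(* Here n >= 2 matters: it gives q < q^n, so X^(q^n) - X has coefficient 0 at X^q. *)
have cardL : (m.+2 < #|fL|)%N.
  rewrite (_ : #|fL| = m.+2 ^ \dim {:L})%N; last first.
    by rewrite -card_Fq -(@card_vspace Fq fL); apply: eq_card => x; rewrite memvf.
  by rewrite -{1}[m.+2]expn1 ltn_exp2l.
rewrite coefB coefXn coefX (ltn_eqF cardL) subrr => /esym e.
rewrite !mulf_eq0 !invr_eq0 (negbTE a0n0) (negbTE b0n0) !orbF.
(* In b0 a1 + b1 a0^q = 0, the vanishing of a1 or of b1 kills one term, and the nonzero factor of
   the other cancels. *)
congr (~~ _); apply/eqP/eqP => z; move: e; rewrite z !(mulr0, mul0r, add0r, addr0) => /eqP.
  by rewrite mulf_eq0 expf_eq0 (negbTE a0n0) andbF orbF => /eqP.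
by rewrite mulf_eq0 (negbTE b0n0) => /eqP.
Qed.

Lemma sum_free_complement (k : nat) : (2 <= \dim {:L})%N -> (k <= \dim {:L})%N ->
  sum_free (\dim {:L} - k) (ginv L m.+1) -> sum_free k (ginv L m.+1).
Proof.
move=> dimL kn sf A [a [W [dimW ->]]].
rewrite big_imset /=; last by move=> x y _ _ /addrI.
have [aW|aW] := boolP (a \in W); last first.
  rewrite (eq_bigr (fun u => (a + u)^-1 ^+ m.+1)) ?sum_inv_affine // => u uW.
  rewrite /ginv exprVn div1r; case: eqVneq => // au0; case/negP: aW.
  by rewrite -(addrK u a) au0 sub0r memvN.
(* Now the coset is [W] itself. The default value of [ginv] at 0 then removes the zero term from the
   sum. *)
have -> : \sum_(u in W) ginv L m.+1 (a + u) = \sum_(u in W) ginv L m.+1 u.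
  rewrite [RHS](reindex_inj (addrI a)) /=; apply: eq_bigl => u.
  by rewrite (rpredDl _ aW).
have sumE (B : {pred fL}) :
    \sum_(u in B) ginv L m.+1 u = \sum_(u in B | u != 0) 1 / u ^+ m.+1.
  rewrite big_mkcondr; apply: eq_bigr => u _; rewrite /ginv.
  by case: eqVneq.
have dWC : directv (W + W^C) by apply/directv_addP; rewrite capv_compl.
rewrite sumE (sum_inv_complement dimL dWC) ?addv_complf // -sumE.
apply: sf; have [F' dimF imF] := subspace_poly_image_vspace dWC.
exists 0, F'; split.
  by rewrite dimF dimv_compl dimW.
apply/setP => x; rewrite imF; apply/idP/imsetP => [xF|[y yF ->]]; last by rewrite add0r.
by exists x; rewrite ?add0r.
Qed.

End InverseSums.

(** * The duality between orders k and n - k *)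

Theorem theorem4p10 (q n : nat) (Fq : finFieldType) (L : fieldExtType Fq)
    (hq : #|Fq| = q) (hn : (2 <= n)%N) (hL : \dim {:L} = n) :
  (forall E F : {vspace finvect_type L},
     (E + F = fullv)%VS -> directv (E + F) ->
     (\sum_(u in E | u != 0) 1 / u ^+ (q - 1) != 0
      <-> \sum_(v in subspace_poly_image E F | v != 0) 1 / v ^+ (q - 1) != 0))
  /\
  (forall k : nat, (1 <= k <= n - 1)%N ->
     (~ sum_free k (ginv L (q - 1)) <-> ~ sum_free (n - k) (ginv L (q - 1)))).
Proof.
have [m qE] : exists m, q = m.+2.
  by exists q.-2; have := finNzRing_gt1 Fq; rewrite hq; case: (q) => [|[|]].
rewrite qE in hq *; rewrite subn1 /= -hL in hn *; split=> [E F EF dEF | k /andP[k1 kn]].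
  by rewrite (sum_inv_complement hq hn dEF EF).
have {}kn : (k <= \dim {:L})%N by rewrite (leq_trans kn) ?leq_subr.
have compl j := @sum_free_complement Fq L m hq j hn.
(* The converse is the same implication applied to n - k, as n - (n - k) = k. *)
split=> nsf sf; apply: nsf; first exact: compl kn sf.
by have := compl _ (leq_subr k _); rewrite subKn //; apply.
Qed.
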